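(* Let $k\in\mathbb{C}$, $k\notin-\frac12-\mathbb{Z}_+$, and $\lambda\in\mathbb{C}$. Let $\tilde\gamma_{r,s}$ be a word in $\tau_\pm^{\pm1}$ whose matrix $\gamma$ (under $\tau_+\mapsto\left(\begin{smallmatrix}1&1\\0&1\end{smallmatrix}\right)$, $\tau_-\mapsto\left(\begin{smallmatrix}1&0\\1&1\end{smallmatrix}\right)$) has first column $(r,s)^{tr}$, with $r,s$ relatively prime integers. Then $$\Bigl(\tilde\gamma_{r,s}\bigl((\phi^{(k)}_\lambda)^{op}\bigr)\Bigr)(1)=e^{-\lambda^2rs}\,\phi^{(k)}_{r\lambda},$$ and consequently the rational invariant $$J^{rat}_{r,s}(\lambda):=\Bigl(\tilde\gamma_{r,s}\bigl((\phi^{(k)}_\lambda)^{op}\bigr)\Bigr)(1)\Big|_{x=0}$$ satisfies $J^{rat}_{r,s}(\lambda)=e^{-\lambda^2rs}$.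
   Context: $\mathbb{Z}_+=\{0,1,2,\dots\}$. The Bessel-type function is $\phi^{(k)}(u)=\sum_{n\ge0}\frac{u^{2n}\,\Gamma(k+1/2)}{n!\,\Gamma(k+n+1/2)}$ and $\phi^{(k)}_\lambda(x)=\phi^{(k)}(\lambda x)$; it is the unique even solution of $L\phi_\lambda=4\lambda^2\phi_\lambda$, $\phi_\lambda(0)=1$, with $L=\frac{d^2}{dx^2}+\frac{2k}{x}\frac{d}{dx}$. $(\phi^{(k)}_\lambda)^{op}$ is the operator of multiplication by $\phi^{(k)}_\lambda(x)$. On functions: $\tau_+(f)=e^{x^2}f$, $\tau_-(f)=e^{-L/4}(f)$; on operators: $\tau_+(A)=e^{x^2}\circ A\circ e^{-x^2}$, $\tau_-(A)=e^{-L/4}\circ A\circ e^{L/4}$. Thus $(\tilde\gamma((\phi_\lambda^{(k)})^{op}))(1)=\tilde\gamma\bigl(\phi^{(k)}_\lambda(x)\,\tilde\gamma^{-1}(1)\bigr)$. Convergence is disregarded: the action of words $\tilde\gamma$ in $\tau_\pm^{\pm1}$ is understood formally through its extension $$\gamma\bigl(\phi^{(k)}_\lambda(x)e^{zx^2}\bigr)=\frac{1}{(cz+d)^{k+1/2}}\,e^{-\frac{c}{cz+d}\lambda^2}\,\phi^{(k)}_{\frac{\lambda}{cz+d}}(x)\,e^{\frac{az+b}{cz+d}x^2},\qquad \gamma=\begin{pmatrix}a&b\\c&d\end{pmatrix}\in SL(2,\mathbb{Z}),$$ for generic $z\in\mathbb{C}$, where $M\mapsto M^{k+1/2}$ is treated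 as multiplicative; $\gamma(\phi_\lambda\gamma^{-1}(1))$ is computed by replacing $1$ by $e^{zx^2}$ with generic $z$ and letting $z\to0$. *)

(* Defs.v *)
From HB Require Import structures.
From mathcomp Require Import all_boot all_order all_algebra.
From mathcomp Require Import complex ring.
From mathcomp Require Import all_classical all_reals all_analysis.

Set Implicit Arguments.
Unset Strict Implicit.
Unset Printing Implicit Defensive.

Import Order.TTheory GRing.Theory Num.Theory.
Import numFieldNormedType.Exports.

Local Open Scope classical_set_scope.
Local Open Scope ring_scope.
Local Open Scope complex_scope.

(* The topology of the modulus on R[i]: the library instances for numeric fields
   are keyed on abstract structures and are not found for R[i] itself. *)
HB.instance Definition _ (R : realType) :=
  PseudoPointedMetric.copy R[i] (R[i])^o.
HB.instance Definition _ (R : realType) := GRing.ComAlgebra.copy R[i] (R[i])^o.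
HB.instance Definition _ (R : realType) := Vector.copy R[i] (R[i])^o.
HB.instance Definition _ (R : realType) := NormedModule.copy R[i] (R[i])^o.

Definition cexp (R : realType) (u : R[i]) : R[i] :=
  (expR (complex.Re u))%:C * (cos (complex.Im u) +i* sin (complex.Im u)).

Lemma cexpD (R : realType) (u v : R[i]) : cexp (u + v) = cexp u * cexp v.
Proof.
case: u v => [a b] [c d]; rewrite /cexp /= expRD cosD sinD.
by apply/eqP; rewrite eq_complex /=; apply/andP; split; apply/eqP; ring.
Qed.

Lemma cexp0 (R : realType) : cexp (0 : R[i]) = 1.
Proof. by rewrite /cexp /= expR0 cos0 sin0 mul1r. Qed.

(* The coefficient Gamma(k+1/2) / (n! Gamma(k+n+1/2)) with the Gamma quotient
   written as 1 / ((k+1/2)(k+3/2)...(k+n-1/2)); phi_coefE shows that this only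
   uses the functional equation of Gamma. *)
Definition phi_coef (R : realType) (k : R[i]) (n : nat) : R[i] :=
  (n`!%:R * \prod_(j < n) (k + 2^-1 + j%:R))^-1.

Lemma phi_coefE (R : realType) (k : R[i]) (Gamma : R[i] -> R[i])
    (GammaS : forall u : R[i], u != 0 -> Gamma (u + 1) = u * Gamma u)
    (Gamma_neq0 : Gamma (k + 2^-1) != 0)
    (hk : forall n : nat, k <> - 2^-1 - n%:R) (n : nat) :
  phi_coef k n = Gamma (k + 2^-1) / (n`!%:R * Gamma (k + n%:R + 2^-1)).
Proof.
have -> : Gamma (k + n%:R + 2^-1)
    = (\prod_(j < n) (k + 2^-1 + j%:R)) * Gamma (k + 2^-1).
  rewrite [k + _ + _]addrAC; elim: n => [|n IHn].
    by rewrite big_ord0 mul1r addr0.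
  rewrite big_ord_recr /= -[n.+1%:R]natr1 addrA GammaS.
    by rewrite IHn; ring.
  apply/eqP => h; apply: (hk n).
  by rewrite -[LHS]subr0 -h; ring.
by rewrite /phi_coef mulrA [in RHS]invfM mulrCA mulfV // mulr1.
Qed.

Definition phi (R : realType) (k u : R[i]) : R[i] :=
  limn (series (fun n : nat => phi_coef k n * u ^+ (2 * n))).

(* M |-> M^kappa as a formal multiplicative power: p is the usual power on the
   positive reals, and p (M * N) = p M * p N is imposed for all nonzero complex
   M and N, which no branch of the analytic power satisfies for general kappa. *)
Definition formal_power (R : realType) (kappa : R[i]) (p : R[i] -> R[i]) :=
  (forall M N : R[i], M != 0 -> N != 0 -> p (M * N) = p M * p N) /\
  (forall t : R, 0 < t -> p t%:C = cexp (kappa * (ln t)%:C)).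

Lemma formal_power_exists (R : realType) (kappa : R[i]) :
  exists p, formal_power kappa p.
Proof.
have normC (M : R[i]) : `|M| = (complex.Re `|M|)%:C by rewrite normc_def.
have norm_gt0 (M : R[i]) : M != 0 -> 0 < complex.Re `|M|.
  by rewrite -normr_gt0 normC ltcR.
exists (fun M => cexp (kappa * (ln (complex.Re `|M|))%:C)); split.
  move=> M N M0 N0.
  rewrite -cexpD -mulrDr -rmorphD /= -lnM ?posrE ?norm_gt0 //.
  by rewrite Normc.normcM.
by move=> t t0; rewrite normc_def /= expr0n addr0 sqrtr_sqr gtr0_norm.
Qed.

Definition gaussian (R : realType) (z : R[i]) : R[i] -> R[i] :=
  fun x => cexp (z * x ^+ 2).

Section GaussBessel.
Context {R : realType}.
Implicit Types (k A mu z : R[i]) (f g : R[i] -> R[i]) (p : R[i] -> R[i]).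
Implicit Types (G H : 'M[int]_2).

(* (A, mu, z) stands for the function A phi_mu(x) e^(z x^2). *)
Definition gbfun k (t : R[i] * R[i] * R[i]) : R[i] -> R[i] :=
  let: (A, mu, z) := t in fun x => A * phi k (mu * x) * cexp (z * x ^+ 2).

(* c z + d for G = (a, b; c, d) *)
Definition gbden G z : R[i] := (G 1 0)%:~R * z + (G 1 1)%:~R.

(* A phi_mu(x) e^(z x^2) |->
   A (cz+d)^-(k+1/2) e^(-c mu^2/(cz+d)) phi_(mu/(cz+d))(x) e^((az+b)/(cz+d) x^2),
   where p plays the role of M |-> M^(k+1/2). *)
Definition gbmove p G (t : R[i] * R[i] * R[i]) : R[i] * R[i] * R[i] :=
  let: (A, mu, z) := t in
  (A * (p (gbden G z))^-1 * cexp (- ((G 1 0)%:~R / gbden G z * mu ^+ 2)),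
   mu / gbden G z,
   ((G 0 0)%:~R * z + (G 0 1)%:~R) / gbden G z).

(* Acting letter by letter along a word therefore agrees, for generic z, with
   acting by the matrix of the word. *)
Lemma gbmoveM k p G H A mu z : formal_power (k + 2^-1) p ->
  \det H = 1 -> gbden H z != 0 ->
  gbden G (((H 0 0)%:~R * z + (H 0 1)%:~R) / gbden H z) != 0 ->
  gbmove p G (gbmove p H (A, mu, z)) = gbmove p (G *m H) (A, mu, z).
Proof.
move=> [pM _] detH H0 G0.
have GH : gbden (G *m H) z =
    gbden G (((H 0 0)%:~R * z + (H 0 1)%:~R) / gbden H z) * gbden H z.
  rewrite mulrDl -mulrA divfK // /gbden !mxE !big_ord_recl !big_ord0 /=.
  have -> : lift ord0 ord0 = 1 :> 'I_2 by apply/val_inj.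
  by rewrite !rmorphD !rmorphM /=; ring.
have detHR : (H 0 0)%:~R * (H 1 1)%:~R - (H 0 1)%:~R * (H 1 0)%:~R = 1 :> R[i].
  rewrite -!rmorphM -rmorphB /= -[RHS]/(1%:~R) -detH (expand_det_row _ 0).
  rewrite !big_ord_recl big_ord0 /cofactor !det_mx11 !mxE /= /bump /=.
  have -> : lift ord0 ord0 = 1 :> 'I_2 by apply/val_inj.
  have -> : lift 1 0 = 0 :> 'I_2 by apply/val_inj.
  by congr (_%:~R); rewrite expr0 expr1; ring.
have ent i j : (G *m H) i j = G i 0 * H 0 j + G i 1 * H 1 j.
  rewrite !mxE !big_ord_recl !big_ord0 addr0 /=.
  by have -> : lift ord0 ord0 = 1 :> 'I_2 by apply/val_inj.
rewrite /gbmove GH pM // !ent !rmorphD !rmorphM /=.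
have dGH : gbden G (((H 0 0)%:~R * z + (H 0 1)%:~R) / gbden H z) * gbden H z =
    (G 1 0)%:~R * ((H 0 0)%:~R * z + (H 0 1)%:~R) + (G 1 1)%:~R * gbden H z.
  by rewrite {1}/gbden mulrDl mulrA divfK.
have dH : gbden H z = (H 1 0)%:~R * z + (H 1 1)%:~R by [].
move: dGH dH G0 H0 detHR.
move: (gbden H z) (gbden G (_ / _)) => dH dG.
move: (p dG) (p dH) => pG pH.
move: (G 0 0)%:~R (G 0 1)%:~R (G 1 0)%:~R (G 1 1)%:~R => a' b' c' d'.
move: (H 0 0)%:~R (H 0 1)%:~R (H 1 0)%:~R (H 1 1)%:~R => a b c d.
move=> dGE dHE dG0 dH0 abcd; congr (_, _, _).
- have <- : cexp (- (c / dH * mu ^+ 2)) * cexp (- (c' / dG * (mu / dH) ^+ 2))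
      = cexp (- ((c' * a + d' * c) / (dG * dH) * mu ^+ 2)).
    rewrite -cexpD; congr (cexp _).
    have E : c * (dG * dH) + c' = (c' * a + d' * c) * dH.
      by rewrite dGE dHE -[X in _ + X]mulr1 -abcd; ring.
    have -> : (c' * a + d' * c) / (dG * dH) =
        ((c' * a + d' * c) * dH) / (dG * dH ^+ 2).
      by field; rewrite dG0 dH0.
    by rewrite -E; field; rewrite dG0 dH0.
  by rewrite invfM; ring.
- by field; rewrite dG0 dH0.
- have -> : (a' * a + b' * c) * z + (a' * b + b' * d) =
      a' * (a * z + b) + b' * dH by rewrite dHE; ring.
  by field; rewrite dG0 dH0.
Qed.

(* The graph of the action of G on C-multiples of the functions
   phi_mu(x) e^(z x^2), at those z with cz + d <> 0. *)
Definition gbgraph k p G f g : Prop :=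
  exists A mu z, [/\ gbden G z != 0,
    f = gbfun k (A, mu, z) & g = gbfun k (gbmove p G (A, mu, z))].

(* Functions to which the formula does not apply are left unchanged. *)
Definition gbact k p G f : R[i] -> R[i] := xget f [set g | gbgraph k p G f g].

End GaussBessel.

(* tau_+, tau_+^-1, tau_-, tau_-^-1 *)
Inductive letter := TauP | TauPinv | TauM | TauMinv.

Definition linv (l : letter) : letter :=
  match l with
  | TauP => TauPinv | TauPinv => TauP | TauM => TauMinv | TauMinv => TauM
  end.

Definition mx2 (a b c d : int) : 'M[int]_2 :=
  \matrix_(i, j) if i == 0 then (if j == 0 then a else b)
                 else (if j == 0 then c else d).

Definition lmx (l : letter) : 'M[int]_2 :=
  match l with
  | TauP => mx2 1 1 0 1
  | TauPinv => mx2 1 (-1) 0 1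
  | TauM => mx2 1 0 1 1
  | TauMinv => mx2 1 0 (-1) 1
  end.

Definition wmx (w : seq letter) : 'M[int]_2 :=
  foldr (fun l G => lmx l *m G) 1%:M w.

Section Words.
Context {R : realType}.
Implicit Types (k : R[i]) (p f : R[i] -> R[i]).
Implicit Types (B : (R[i] -> R[i]) -> (R[i] -> R[i])).

(* tau_+ is multiplication by e^(x^2).  tau_- = e^(-L/4), for
   L = d^2/dx^2 + (2k/x) d/dx, is understood through its formal extension to
   the functions phi_mu(x) e^(z x^2); at z = 0 this is
   e^(-L/4) phi_mu = e^(-mu^2) phi_mu, in accordance with
   L phi_mu = 4 mu^2 phi_mu. *)
Definition lact k p (l : letter) f : R[i] -> R[i] :=
  match l with
  | TauP => fun x => cexp (x ^+ 2) * f x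
  | TauPinv => fun x => cexp (- x ^+ 2) * f x
  | TauM | TauMinv => gbact k p (lmx l) f
  end.

Definition lact_op k p (l : letter) B : (R[i] -> R[i]) -> (R[i] -> R[i]) :=
  lact k p l \o B \o lact k p (linv l).

Definition wact_op k p (w : seq letter) B : (R[i] -> R[i]) -> (R[i] -> R[i]) :=
  foldr (lact_op k p) B w.

Definition phi_op k (lambda : R[i]) : (R[i] -> R[i]) -> (R[i] -> R[i]) :=
  fun f x => phi k (lambda * x) * f x.

(* B(1) is the limit of B(e^(z x^2)) as z tends to 0 through z <> 0. *)
Definition cvg_at1 B := forall x : R[i], cvg (B (gaussian z) x @[z --> 0^']).

Definition at1 B : R[i] -> R[i] := fun x => lim (B (gaussian z) x @[z --> 0^']).

Definition Jrat k p (w : seq letter) (lambda : R[i]) : R[i] :=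
  at1 (wact_op k p w (phi_op k lambda)) 0.

End Words.

(* Main.v *)
Require Import Defs.
From mathcomp Require Import all_boot all_order all_algebra.
From mathcomp Require Import complex ring lra.
From mathcomp Require Import all_classical all_reals all_analysis.

Set Implicit Arguments.
Unset Strict Implicit.
Unset Printing Implicit Defensive.

Import Order.TTheory GRing.Theory Num.Theory.
Import numFieldNormedType.Exports.

Local Open Scope classical_set_scope.
Local Open Scope ring_scope.
Local Open Scope complex_scope.

(** Everything happens on the functions A phi_mu(x) e^(z x^2), on which each
    letter acts by its matrix, a Moebius transformation of z.  For generic z
    put delta = r - s z.  The inverse word sends e^(z x^2) to a multiple of
    e^(z' x^2) with z' = gamma^-1 z; multiplication by phi_lambda only changes
    mu from 0 to lambda; and the word brings z' back to z, cancels the power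
    factor, because its denominator at z' is 1 / delta, and leaves
      e^(- lambda^2 s delta) phi_(lambda delta)(x) e^(z x^2).
    Letting z tend to 0 turns delta into r, and the theorem follows.  The
    formula is proved one letter at a time in [wact_gbfun]: the pair
    (letter, inverse letter) wrapped around a shorter word transforms the first
    column (r, s) by the matrix of the letter, and finitely many values of z
    have to be avoided for the denominators not to vanish.

    Two points are not formal.

    First, the action is defined on functions, by choosing some presentation
    A phi_mu(x) e^(z x^2), so one has to know that the result does not depend on
    the choice.  It does not, since a nonzero function of this kind determines
    A, mu^2 and z ([gbfun_inj]), and phi is even.  The value at 0 gives A.  If z
    differed from z', a change of variable would give, for q = k + 1/2,
      (sum_n b_n alpha^n t^n) e^t = sum_n b_n beta^n t^n,
      b_n = 1 / (n! q (q+1) ... (q+n-1)),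
    for all real t, and the coefficients of t, t^2 and t^3 are already
    incompatible ([bessel_gauss_absurd]).

    Second, the limit z -> 0 uses that phi and the exponential are continuous on
    the complex plane.  The coefficients of phi are dominated by C K^n / n!,
    because k + 1/2 stays away from the nonpositive integers; all the facts on
    power series used here are derived from this domination by the real
    exponential series. *)

(** * Limits and dominated series of complex numbers *)

Section ComplexLimits.
Context {R : realType}.
Implicit Types (x y z : R[i]).
Local Notation Re := (@complex.Re R).
Local Notation Im := (@complex.Im R).

Lemma normc_le_ReIm x : `|x| <= (`|Re x| + `|Im x|)%:C.
Proof.
rewrite {1}(complexE x); apply: (le_trans (ler_normD _ _)).
rewrite normrM normc_def /= expr0n addr0 sqrtr_sqr.
rewrite normc_def /= expr0n expr1n add0r sqrtr1 mul1r.
by rewrite normc_def /= expr0n addr0 sqrtr_sqr -rmorphD.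
Qed.

Lemma normc_ge_ReIm x :
  (`|Re x|%:C <= `|x|) /\ (`|Im x|%:C <= `|x|).
Proof.
split; first exact: normc_ge_Re.
rewrite normc_def lecR -sqrtr_sqr; apply: ler_wsqrtr.
by rewrite lerDr sqr_ge0.
Qed.

Lemma gt0_realC (e : R[i]) : 0 < e -> exists2 d : R, 0 < d & e = d%:C.
Proof.
case: e => a b; rewrite ltcE /= => /andP[/eqP b0 a0]; exists a => //.
by rewrite b0.
Qed.

Lemma cvg_ReIm T (F : set_system T) {FF : Filter F} (f : T -> R[i]) (l : R[i]) :
  (Re \o f) @ F --> Re l ->
  (Im \o f) @ F --> Im l -> f @ F --> l.
Proof.
move=> /cvgrPdist_le fr /cvgrPdist_le fi; apply/cvgrPdist_le => e e0.
have [d d0 ->] := gt0_realC e0.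
have d20 : 0 < d / 2 by rewrite divr_gt0.
near=> t; apply: (le_trans (normc_le_ReIm _)).
rewrite lecR (splitr d) !raddfB /= lerD //.
  by near: t; exact: fr.
by near: t; exact: fi.
Unshelve. all: by end_near. Qed.

Lemma cvg_real_complex T (F : set_system T) {FF : Filter F} (f : T -> R) (l : R) :
  f @ F --> l -> (fun t => (f t)%:C) @ F --> l%:C.
Proof. by move=> fl; apply: cvg_ReIm => //=; exact: cvg_cst. Qed.

Lemma near_dist (x : R[i]) (e : R) : 0 < e -> \forall y \near x, `|x - y| <= e%:C.
Proof.
move=> e0; have e0' : 0 < e%:C :> R[i] by rewrite ltcR.
exact: (proj1 (@cvgrPdist_le _ _ _ _ (nbhs_filter x) id x) (@cvg_id _ _) _ e0').
Qed.

Lemma Re_continuous : continuous (Re : R[i] -> R).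
Proof.
move=> x; apply: (proj2 (@cvgrPdist_le _ _ _ _ (nbhs_filter x) Re (Re x))).
move=> e e0; apply: filterS (near_dist x e0) => y; rewrite -lecR; apply: le_trans.
by rewrite -raddfB /=; have [] := normc_ge_ReIm (x - y).
Qed.

Lemma Im_continuous : continuous (Im : R[i] -> R).
Proof.
move=> x; apply: (proj2 (@cvgrPdist_le _ _ _ _ (nbhs_filter x) Im (Im x))).
move=> e e0; apply: filterS (near_dist x e0) => y; rewrite -lecR; apply: le_trans.
by rewrite -raddfB /=; have [] := normc_ge_ReIm (x - y).
Qed.

Lemma continuous_at_dist (f : R[i] -> R[i]) (x : R[i]) :
  (forall e : R, 0 < e -> \forall y \near x, `|f x - f y| <= e%:C) ->
  {for x, continuous f}.
Proof.
move=> h; apply: (proj2 (@cvgrPdist_le _ _ _ _ (nbhs_filter x) f (f x))) => e e0.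
by have [d d0 ->] := gt0_realC e0; exact: h.
Qed.

Lemma cexp_continuous : continuous (@cexp R).
Proof.
move=> x; have FF := nbhs_filter x.
have cR : expR (Re y) @[y --> x] --> expR (Re x).
  exact: (cvg_comp _ _ (@Re_continuous x) (@continuous_expR _ _)).
have cC : cos (Im y) @[y --> x] --> cos (Im x).
  exact: (cvg_comp _ _ (@Im_continuous x) (@continuous_cos _ _)).
have cS : sin (Im y) @[y --> x] --> sin (Im x).
  exact: (cvg_comp _ _ (@Im_continuous x) (@continuous_sin _ _)).
apply: (@cvg_ReIm _ _ FF).
  have -> : Re \o @cexp R = (fun y => expR (Re y) * cos (Im y)).
    by apply/funext => y; rewrite /cexp /= mul0r subr0.
  by rewrite [Re _]/= mul0r subr0; apply: (@cvgM _ _ _ FF).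
have -> : Im \o @cexp R = (fun y => expR (Re y) * sin (Im y)).
  by apply/funext => y; rewrite /cexp /= mul0r addr0.
by rewrite [Im _]/= mul0r addr0; apply: (@cvgM _ _ _ FF).
Qed.

Lemma lim_normc_le (u : nat -> R[i]) (l : R[i]) (B : R) :
  u @ \oo --> l -> (forall n, `|u n| <= B%:C) -> `|l| <= B%:C.
Proof.
move=> /cvgrPdist_le ul uB; apply/ler_addgt0Pr => e e0.
have [n _ /(_ n (leqnn n)) /= un] := ul e e0.
rewrite -(subrK (u n) l); apply: (le_trans (ler_normD _ _)).
by rewrite addrC lerD.
Qed.

(** The real and imaginary parts are dominated by the same real series, so the
    completeness of R suffices. *)
Lemma is_cvg_series_dominated (u : nat -> R[i]) (v : nat -> R) :
  (forall n, `|u n| <= (v n)%:C) -> cvgn (series v) -> cvgn (series u).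
Proof.
move=> uv cv.
have part (f : R[i] -> R) : {morph f : x y / x + y} -> f 0 = 0 ->
    (forall x, `|f x|%:C <= `|x|) -> cvgn (series (f \o u)).
  move=> fD f0 fle; apply: normed_cvg; apply: series_le_cvg cv => n /=.
  - exact: normr_ge0.
  - by rewrite -lecR; apply: le_trans (uv n); exact: le_trans (normr_ge0 _) _.
  - by rewrite -lecR; apply: le_trans (uv n).
have cR := part Re (fun x y => raddfD _ x y) erefl
  (fun x => (normc_ge_ReIm x).1).
have cI := part Im (fun x y => raddfD _ x y) erefl
  (fun x => (normc_ge_ReIm x).2).
apply/cvg_ex; exists (limn (series (Re \o u)) +i*
  limn (series (Im \o u))).
apply: cvg_ReIm => /=.
  by rewrite (_ : _ \o _ = series (Re \o u)) //; apply/funext => n;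
    rewrite /series /= raddf_sum.
by rewrite (_ : _ \o _ = series (Im \o u)) //; apply/funext => n;
  rewrite /series /= raddf_sum.
Qed.

Lemma lim_series_dominated (u : nat -> R[i]) (v : nat -> R) :
  (forall n, `|u n| <= (v n)%:C) -> cvgn (series v) ->
  `|limn (series u)| <= (limn (series v))%:C.
Proof.
move=> uv cv; apply: (lim_normc_le (is_cvg_series_dominated uv cv)) => n.
have v0 m : 0 <= v m by rewrite -lecR; exact: le_trans (normr_ge0 _) (uv m).
apply: (@le_trans _ _ (series v n)%:C).
  rewrite /series /= rmorph_sum /=; apply: le_trans (ler_norm_sum _ _ _) _.
  exact: ler_sum.
rewrite lecR; apply: nondecreasing_cvgn_le cv _.
by apply: nondecreasing_series => m _ _.
Qed.

End ComplexLimits.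

(** * Power series dominated by an exponential series *)

Section PowerSeries.
Context {R : realType}.
Implicit Types (a b : nat -> R[i]) (t s c : R[i]).

Lemma series_exp_dominated (u : nat -> R[i]) (C K : R) :
  (forall n, `|u n| <= (C * exp_coeff K n)%:C) ->
  cvgn (series u) /\ `|limn (series u)| <= (C * expR K)%:C.
Proof.
move=> uv.
have cv : cvgn (series (C *: exp_coeff K)).
  exact: is_cvg_seriesZ (is_cvg_series_exp_coeff K).
split; first exact: is_cvg_series_dominated uv cv.
have := lim_series_dominated uv cv.
by rewrite lim_seriesZ //; exact: is_cvg_series_exp_coeff.
Qed.

(** The sum of such coefficients is an entire function of exponential type.  The
    condition is stable under shifting and scaling, and comparison with the
    exponential series replaces any discussion of radii of convergence. *)
Definition exp_type a :=
  exists C K : R, 0 <= K /\ forall n, `|a n| <= (C * exp_coeff K n)%:C.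

Definition psum a t : R[i] := limn (series (fun n => a n * t ^+ n)).

Lemma psum_term_le a t (C K T : R) : 0 <= K -> `|t| <= T%:C ->
  (forall n, `|a n| <= (C * exp_coeff K n)%:C) ->
  forall n, `|a n * t ^+ n| <= (C * exp_coeff (K * T) n)%:C.
Proof.
move=> K0 tT aK n; rewrite normrM normrX.
have -> : (C * exp_coeff (K * T) n)%:C = (C * exp_coeff K n)%:C * T%:C ^+ n.
  by rewrite -rmorphXn -rmorphM /= /exp_coeff /= exprMn; congr (_%:C); ring.
by apply: ler_pM => //; rewrite ?exprn_ge0 // lerXn2r ?nnegrE //
  (le_trans _ tT).
Qed.

Lemma normc_realP t : exists2 T : R, 0 <= T & `|t| = T%:C.
Proof.
exists (Num.sqrt (complex.Re t ^+ 2 + complex.Im t ^+ 2)); first exact: sqrtr_ge0.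
exact: normc_def.
Qed.

Lemma is_cvg_psum a t : exp_type a -> cvgn (series (fun n => a n * t ^+ n)).
Proof.
move=> [C [K [K0 aK]]]; have [T T0 tT] := normc_realP t.
have tT' : `|t| <= T%:C by rewrite tT.
by have [] := series_exp_dominated (psum_term_le K0 tT' aK).
Qed.

Lemma psum_bounded a (T : R) : exp_type a ->
  exists B : R, forall t, `|t| <= T%:C -> `|psum a t| <= B%:C.
Proof.
move=> [C [K [K0 aK]]]; exists (C * expR (K * T)) => t tT.
by have [] := series_exp_dominated (psum_term_le K0 tT aK).
Qed.

Lemma exp_type_shift a : exp_type a -> exp_type (fun n => a n.+1).
Proof.
move=> [C [K [K0 aK]]]; have C0 : 0 <= C.
  have := le_trans (normr_ge0 _) (aK 0%N).
  by rewrite lecR /exp_coeff /= expr0 divr1 mulr1.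
exists (C * K), K; split=> // n; apply: (le_trans (aK _)); rewrite lecR.
rewrite -mulrA ler_wpM2l // /exp_coeff /= exprS -!mulrA ler_wpM2l //.
rewrite ler_wpM2l ?exprn_ge0 // lef_pV2 ?posrE ?ltr0n ?fact_gt0 //.
by rewrite ler_nat factS leq_pmull.
Qed.

Lemma exp_type_scale a c : exp_type a -> exp_type (fun n => a n * c ^+ n).
Proof.
move=> [C [K [K0 aK]]]; have [T T0 cT] := normc_realP c.
exists C, (K * T); split; first exact: mulr_ge0.
by apply: psum_term_le => //; rewrite cT.
Qed.

Lemma psum_scale a c t : psum (fun n => a n * c ^+ n) t = psum a (c * t).
Proof.
by rewrite /psum; congr (limn (series _)); apply/funext => n; rewrite exprMn mulrA.
Qed.

Lemma psumS a t : exp_type a -> psum a t = a 0%N + t * psum (fun n => a n.+1) t.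
Proof.
move=> ea; have ca := @is_cvg_psum _ t ea.
have cs := @is_cvg_psum _ t (exp_type_shift ea).
apply: cvg_lim; first exact: norm_hausdorff.
rewrite -(cvg_shiftS (series _)).
have -> : (fun n => series (fun n => a n * t ^+ n) n.+1) =
    (fun n => a 0%N + t * series (fun n => a n.+1 * t ^+ n) n).
  apply/funext => n; rewrite /series /= big_nat_recl // expr0 mulr1 mulr_sumr.
  by congr (_ + _); apply: eq_bigr => i _; rewrite exprS; ring.
by apply: cvgD; [exact: cvg_cst | apply: cvgMr].
Qed.

Lemma psum0 a : exp_type a -> psum a 0 = a 0%N.
Proof. by move=> ea; rewrite psumS // mul0r addr0. Qed.

(** Taylor expansion with a remainder of the same kind, hence bounded on bounded
    sets. *)
Lemma psum_take a N : exp_type a ->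
  exists b, exp_type b /\
  forall t, psum a t = (\poly_(i < N) a i).[t] + t ^+ N * psum b t.
Proof.
elim: N a => [|N IH] a ea.
  by exists a; split=> // s; rewrite poly_def big_ord0 horner0 add0r mul1r.
have [b [eb ab]] := IH _ (exp_type_shift ea).
exists b; split=> // s; rewrite psumS // ab !horner_poly big_ord_recl /= expr0.
rewrite mulr1 mulrDr mulr_sumr exprS addrA mulrA; congr (_ + _ + _).
by apply: eq_bigr => i _; rewrite /bump /= add1n exprS; ring.
Qed.

(** The sharp factor n T^(n-1) is replaced by (2 T)^n so that, in
    [psum_continuous], the differences of the terms are again dominated by an
    exponential series. *)
Lemma normXB_le s t (T : R) n : `|s| <= T%:C -> `|t| <= T%:C -> 1 <= T ->
  `|s ^+ n - t ^+ n| <= `|s - t| * ((2 * T) ^+ n)%:C.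
Proof.
move=> sT tT T1; have T0 : 0 <= T by apply: le_trans T1.
have XT u m : `|u| <= T%:C -> `|u ^+ m| <= (T ^+ m)%:C.
  by move=> uT; rewrite normrX rmorphXn lerXn2r ?nnegrE // (le_trans _ uT).
elim: n => [|n IH]; first by rewrite subrr normr0 mulr_ge0 // lecR exprn_ge0.
have -> : s ^+ n.+1 - t ^+ n.+1 = s * (s ^+ n - t ^+ n) + (s - t) * t ^+ n.
  by rewrite !exprS; ring.
apply: (le_trans (ler_normD _ _)); rewrite !normrM.
have -> : ((2 * T) ^+ n.+1)%:C =
    (T * (2 * T) ^+ n)%:C + (T * (2 * T) ^+ n)%:C :> R[i].
  by rewrite -rmorphD exprS; congr (_%:C); ring.
rewrite mulrDr; apply: lerD.
  by rewrite rmorphM mulrCA; apply: ler_pM.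
rewrite ler_wpM2l //; apply: (le_trans (XT _ _ tT)); rewrite lecR.
rewrite exprMn mulrA -[leLHS]mul1r ler_wpM2r ?exprn_ge0 // -[leLHS]mul1r.
by apply: ler_pM => //; rewrite exprn_ege1 // ler1n.
Qed.

(** On each disk the sum is Lipschitz, by [normXB_le]. *)
Lemma psum_continuous a : exp_type a -> continuous (psum a).
Proof.
move=> ea t; apply: continuous_at_dist => e e0.
have [C [K [K0 aK]]] := ea; have [T' T'0 tT'] := normc_realP t.
pose T := T' + 1; pose D := C * expR (K * (2 * T)).
(* The disk of radius T contains the disk of radius 1 around t. *)
have T1 : 1 <= T by rewrite /T lerDr.
have C0 : 0 <= C.
  have := le_trans (normr_ge0 _) (aK 0%N).
  by rewrite lecR /exp_coeff /= expr0 divr1 mulr1.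
have D0 : 0 <= D by rewrite mulr_ge0 // expR_ge0.
have tT : `|t| <= T%:C by rewrite tT' lecR /T lerDl.
have lip s : `|s| <= T%:C -> `|psum a t - psum a s| <= `|t - s| * D%:C.
  move=> sT; have [X X0 tsX] := normc_realP (t - s).
  have ct := @is_cvg_psum _ t ea; have cs := @is_cvg_psum _ s ea.
  have <- : limn (series (fun n => a n * (t ^+ n - s ^+ n)))
      = psum a t - psum a s.
    apply: cvg_lim; first exact: norm_hausdorff.
    have -> : series (fun n => a n * (t ^+ n - s ^+ n)) = fun n =>
        series (fun n => a n * t ^+ n) n - series (fun n => a n * s ^+ n) n.
      apply/funext => n; rewrite /series /= -sumrB.
      by apply: eq_bigr => i _; rewrite mulrBr.
    exact: cvgB ct cs.
  have -> : `|t - s| * D%:C = (X * C * expR (K * (2 * T)))%:C.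
    by rewrite tsX -rmorphM /= -mulrA.
  apply: (series_exp_dominated _).2 => n /=.
  rewrite normrM.
  have -> : (X * C * exp_coeff (K * (2 * T)) n)%:C =
      (C * exp_coeff K n)%:C * (`|t - s| * ((2 * T) ^+ n)%:C).
    rewrite tsX -!rmorphM; congr (_%:C); rewrite /exp_coeff /= exprMn; ring.
  by apply: ler_pM => //; exact: normXB_le.
have d0 : 0 < e / (D + 1) by rewrite divr_gt0 // ltr_wpDl.
have := near_dist t (ltr01 : 0 < 1 :> R).
have := near_dist t d0.
apply: filterS2 => s sd s1.
have sT : `|s| <= T%:C.
  have -> : T%:C = 1%:C + `|t| by rewrite tT' -rmorphD addrC.
  rewrite -[s](subrK t); apply: le_trans (ler_normD _ _) _.
  by rewrite lerD2r distrC.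
apply: (le_trans (lip s sT)).
have -> : e%:C = (e / (D + 1))%:C * (D + 1)%:C :> R[i].
  by rewrite -rmorphM divfK // gt_eqF // ltr_wpDl.
by apply: ler_pM => //; rewrite lecR // lerDl.
Qed.

End PowerSeries.

(** * The Bessel-type function *)

Section Bessel.
Context {R : realType}.
Implicit Types (k u v : R[i]).

Lemma shift_neq0 k : (forall n : nat, k <> - 2^-1 - n%:R) ->
  forall n : nat, k + 2^-1 + n%:R != 0.
Proof.
by move=> hk n; apply/eqP => h; apply: (hk n); rewrite -[LHS]subr0 -h; ring.
Qed.

(** Only finitely many of the nonzero numbers k + 1/2 + j have modulus less than
    1, since this modulus is at least j - |k + 1/2|. *)
Lemma shift_bounded_below k : (forall n : nat, k <> - 2^-1 - n%:R) ->
  exists2 d : R, 0 < d & forall j : nat, d%:C <= `|k + 2^-1 + j%:R|.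
Proof.
move=> hk; set q := k + 2^-1.
have q0 := shift_neq0 hk.
have fin N : exists2 d : R, 0 < d <= 1 & forall j, (j < N)%N -> d%:C <= `|q + j%:R|.
  elim: N => [|N [d /andP[d0 d1] dj]]; first by exists 1; rewrite ?ltr01 ?lexx.
  have [T T0 qT] := normc_realP (q + N%:R).
  have T_gt0 : 0 < T by rewrite -ltcR -qT normr_gt0.
  exists (Num.min d T); first by rewrite lt_min d0 T_gt0 ge_min d1.
  move=> j; rewrite ltnS leq_eqVlt => /orP[/eqP ->|jN].
    by rewrite qT lecR ge_min lexx orbT.
  by apply: le_trans (dj j jN); rewrite lecR ge_min lexx.
have [T T0 qT] := normc_realP q.
have [d /andP[d0 d1] dj] := fin (Num.bound T).+1.
exists d => // j; have [jN|Nj] := ltnP j (Num.bound T).+1; first exact: dj.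
apply: (@le_trans _ _ (j%:R - `|q|)).
  rewrite qT -(rmorph_nat (real_complex R)) -rmorphB lecR.
  have := archi_boundP T0 => TN.
  have : ((Num.bound T).+1%:R : R) <= j%:R by rewrite ler_nat.
  rewrite -natr1; lra.
rewrite lerBlDr -[leLHS](ger0_norm (ler0n _ _)).
have {1}-> : j%:R = (q + j%:R) - q by ring.
exact: ler_normB.
Qed.

Lemma phi_coef_exp_type k : (forall n : nat, k <> - 2^-1 - n%:R) ->
  exp_type (phi_coef k).
Proof.
move=> /shift_bounded_below[d d0 dj]; exists 1, d^-1.
split=> [|n]; first by rewrite invr_ge0 ltW.
rewrite mul1r /exp_coeff /phi_coef /= normfV normrM invfM mulrC.
rewrite rmorphM fmorphV rmorph_nat normr_nat exprVn fmorphV rmorphXn /=.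
rewrite ler_wpM2r ?invr_ge0 ?ler0n // normr_prod.
have dn0 : 0 < d%:C :> R[i] by rewrite ltcR.
rewrite lef_pV2 ?posrE ?exprn_gt0 //; last first.
  by apply: prodr_gt0 => j _; apply: lt_le_trans (dj j).
rewrite -[X in _ ^+ X](card_ord n) -prodr_const.
by apply: ler_prod => j _; rewrite dj andbT ltW.
Qed.

Lemma phiE k u : phi k u = psum (phi_coef k) (u ^+ 2).
Proof.
by rewrite /phi /psum; congr (limn (series _)); apply/funext => n; rewrite exprM.
Qed.

Lemma phi_coef0 k : phi_coef k 0 = 1.
Proof. by rewrite /phi_coef big_ord0 fact0 mulr1 invr1. Qed.

Lemma phi_coefS k n :
  phi_coef k n.+1 = phi_coef k n / (n.+1%:R * (k + 2^-1 + n%:R)).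
Proof.
rewrite /phi_coef big_ord_recr /= factS natrM -invfM; congr (_^-1); ring.
Qed.

Lemma phi_sqr k u v : u ^+ 2 = v ^+ 2 -> phi k u = phi k v.
Proof. by move=> uv; rewrite !phiE uv. Qed.

Variable k : R[i].
Hypothesis hk : forall n : nat, k <> - 2^-1 - n%:R.

Lemma phi0 : phi k 0 = 1.
Proof.
by rewrite phiE expr0n psum0 ?phi_coef0 //; exact: phi_coef_exp_type.
Qed.

Lemma phi_continuous : continuous (phi k).
Proof.
move=> u.
have -> : phi k = psum (phi_coef k) \o (fun v => v ^+ 2).
  by apply/funext => v; rewrite phiE.
have cp := @psum_continuous _ _ (phi_coef_exp_type hk) (u ^+ 2).
have FF := nbhs_filter (u : R[i]).
have sq : v ^+ 2 @[v --> u] --> u ^+ 2.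
  by apply: (@cvgM _ _ _ FF); exact: cvg_id.
exact: (@cvg_comp _ _ _ _ _ _ _ _ sq cp).
Qed.

End Bessel.

(** * Expansions at the origin along the positive reals *)

Section Jets.
Context {R : realType}.
Implicit Types (p q : {poly R[i]}) (f g : R -> R[i]).

(** The expansion f(s) = p(s) + O(s^N) as s tends to 0, with a uniform constant
    on ]0, 1].  It determines p modulo X^N; with p a polynomial of any degree, the
    expansion of a product is the product of the polynomials. *)
Definition jet N f p := exists M : R, forall s : R, 0 < s <= 1 ->
  `|f s - p.[s%:C]| <= (M * s ^+ N)%:C.

Lemma poly_bounded p : exists B : R, forall s : R, 0 < s <= 1 ->
  `|p.[s%:C]| <= B%:C.
Proof.
have [B B0 pB] := normc_realP (\sum_(i < size p) `|p`_i|).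
exists B => s /andP[s0 s1].
rewrite -pB [leRHS]ger0_norm ?sumr_ge0 // horner_coef.
apply: le_trans (ler_norm_sum _ _ _) _; apply: ler_sum => i _.
rewrite normrM -[leRHS]mulr1 ler_wpM2l // -rmorphXn normc_def /= expr0n addr0.
by rewrite sqrtr_sqr ger0_norm ?exprn_ge0 ?lecR ?exprn_ile1 // ltW.
Qed.

Lemma le0_small (T D : R) : (forall s : R, 0 < s <= 1 -> T <= D * s) -> T <= 0.
Proof.
move=> h; case: leP => // T0.
have TD : T <= D by have := h 1; rewrite mulr1 ltr01 lexx; apply.
have D0 : 0 < D by apply: lt_le_trans TD.
have : T <= D * (T / (2 * D)).
  apply: h; rewrite divr_gt0 ?mulr_gt0 //= ler_pdivrMr ?mulr_gt0 //; lra.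
have -> : D * (T / (2 * D)) = T / 2 by field; rewrite gt_eqF.
lra.
Qed.

(** The constant coefficient is O(s), hence zero; then divide by s. *)
Lemma jet0_coef N p : jet N (fun=> 0) p -> forall i, (i < N)%N -> p`_i = 0.
Proof.
elim: N p => // N IH p [M pM].
set q := drop_poly 1 p.
have pE (s : R[i]) : p.[s] = p`_0 + q.[s] * s.
  rewrite -[in LHS](poly_take_drop 1 p) hornerD hornerM hornerXn expr1.
  by rewrite /take_poly horner_poly big_ord1 expr0 mulr1.
have p00 : p`_0 = 0.
  have [T T0 pT] := normc_realP p`_0; have [B qB] := poly_bounded q.
  suff T00 : T = 0 by apply/eqP; rewrite -normr_eq0 pT T00.
  apply/eqP; rewrite eq_le T0 andbT.
  apply: (@le0_small _ (`|M| + B)) => s /[dup] sI /andP[s0 s1].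
  rewrite -lecR -pT -[p`_0](addrK (q.[s%:C] * s%:C)) -pE mulrDl rmorphD.
  apply: le_trans (ler_normB _ _) _; apply: lerD.
    have := pM s sI; rewrite sub0r normrN => /le_trans; apply; rewrite lecR.
    apply: (@le_trans _ _ (`|M| * s ^+ N.+1)).
      by rewrite ler_wpM2r ?ler_norm // exprn_ge0 // ltW.
    by rewrite ler_wpM2l // exprS -[leRHS]mulr1 ler_pM2l // exprn_ile1 // ltW.
  rewrite normrM rmorphM ler_pM // ?qB //.
  by rewrite normc_def /= expr0n addr0 sqrtr_sqr gtr0_norm.
have jq : jet N (fun=> 0) q.
  exists M => s /[dup] sI /andP[s0 s1]; have := pM s sI.
  rewrite !sub0r !normrN pE p00 add0r.
  rewrite normrM exprSr mulrA rmorphM.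
  have -> : `|s%:C| = s%:C.
    by rewrite normc_def /= expr0n addr0 sqrtr_sqr gtr0_norm.
  by rewrite ler_pM2r // ltcR.
case=> [_|i iN] //; have := IH q jq i iN.
by rewrite coef_drop_poly addn1.
Qed.

Lemma jet_unique N f p q : jet N f p -> jet N f q ->
  forall i, (i < N)%N -> p`_i = q`_i.
Proof.
move=> [M fM] [M' fM'] i iN; apply/eqP; rewrite -subr_eq0 -coefB.
apply/eqP/(jet0_coef _ iN); exists (M + M') => s sI.
have -> : 0 - (p - q).[s%:C] = (f s - p.[s%:C]) - (f s - q.[s%:C]).
  by rewrite hornerD hornerN; ring.
by rewrite mulrDl rmorphD (le_trans (ler_normB _ _)) // lerD ?fM ?fM'.
Qed.

Lemma jet_mul N f g p q : jet N f p -> jet N g q ->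
  jet N (fun s => f s * g s) (p * q).
Proof.
move=> [M fM] [M' gM'].
have [B pB] := poly_bounded p; have [B' qB'] := poly_bounded q.
have gB s : 0 < s <= 1 -> `|g s| <= (`|M'| + B')%:C.
  move=> /[dup] sI /andP[s0 s1]; rewrite -[g s](subrK q.[s%:C]) rmorphD.
  rewrite (le_trans (ler_normD _ _)) // lerD ?qB' // (le_trans (gM' _ sI)) //.
  rewrite lecR (@le_trans _ _ (`|M'| * s ^+ N)) //.
    by rewrite ler_wpM2r ?ler_norm // exprn_ge0 // ltW.
  by rewrite -[leRHS]mulr1 ler_wpM2l // exprn_ile1 // ltW.
exists (M * (`|M'| + B') + B * M') => s sI.
rewrite hornerM.
have -> : f s * g s - p.[s%:C] * q.[s%:C] =
  (f s - p.[s%:C]) * g s + p.[s%:C] * (g s - q.[s%:C]) by ring.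
have -> : (M * (`|M'| + B') + B * M') * s ^+ N =
  (M * s ^+ N) * (`|M'| + B') + B * (M' * s ^+ N) by ring.
rewrite rmorphD (le_trans (ler_normD _ _)) // !normrM rmorphM (rmorphM _ B).
by rewrite lerD // ler_pM // ?fM ?gB ?pB ?gM'.
Qed.

Lemma jet_psum N (a : nat -> R[i]) : exp_type a ->
  jet N (fun s => psum a s%:C) (\poly_(i < N) a i).
Proof.
move=> ea; have [b [eb ab]] := psum_take N ea.
have [B bB] := psum_bounded 1 eb.
exists B => s /andP[s0 s1]; rewrite ab addrC addKr normrM mulrC rmorphM.
have ss : `|s%:C| = s%:C.
  by rewrite normc_def /= expr0n addr0 sqrtr_sqr gtr0_norm.
apply: ler_pM => //; last by rewrite normrX ss rmorphXn.
by apply: bB; rewrite ss lecR.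
Qed.

End Jets.

(** * The parameters of a function A phi_mu(x) e^(z x^2) *)

(** The hypotheses say that the coefficients of t, t^2 and t^3 agree in
    (sum_n b_n al^n t^n) e^t = sum_n b_n be^n t^n.  The first one gives
    be = al + q, then the second one 2 al + q = 0, and with these values the two
    sides of the third one differ by - 1 / (6 (q + 1) (q + 2)). *)
Lemma bessel_gauss_absurd (F : numFieldType) (q al be : F) :
  q != 0 -> q + 1 != 0 -> q + 2 != 0 ->
  1 + q^-1 * al = q^-1 * be ->
  2^-1 + (q^-1 * al + q^-1 / (2 * (q + 1)) * al ^+ 2) =
    q^-1 / (2 * (q + 1)) * be ^+ 2 ->
  6^-1 + (q^-1 * al / 2 + (q^-1 / (2 * (q + 1)) * al ^+ 2 +
    q^-1 / (2 * (q + 1)) / (3 * (q + 2)) * al ^+ 3)) =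
    q^-1 / (2 * (q + 1)) / (3 * (q + 2)) * be ^+ 3 ->
  False.
Proof.
move=> q0 q1 q2 E1 E2 E3.
have beE : be = al + q.
  by rewrite -[be](mulKf q0) mulrCA -E1; field.
have alE : al = - q / 2.
  have : 2 * al + q = (2^-1 + (q^-1 * al + q^-1 / (2 * (q + 1)) * al ^+ 2) -
      q^-1 / (2 * (q + 1)) * be ^+ 2) * (2 * q * (q + 1)).
    by rewrite beE; field; rewrite q0 q1.
  rewrite E2 subrr mul0r => /eqP; rewrite addr_eq0 => /eqP h.
  by rewrite -h; field.
have : (1 : F) = - 6 * (q + 1) * (q + 2) * (
    6^-1 + (q^-1 * al / 2 + (q^-1 / (2 * (q + 1)) * al ^+ 2 +
    q^-1 / (2 * (q + 1)) / (3 * (q + 2)) * al ^+ 3)) -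
    q^-1 / (2 * (q + 1)) / (3 * (q + 2)) * be ^+ 3).
  by rewrite beE alE; field; rewrite q0 q1 q2.
by rewrite E3 subrr mulr0 => /eqP; rewrite oner_eq0.
Qed.

Section Uniqueness.
Context {R : realType}.
Implicit Types (A mu z m w : R[i]).

(* The Taylor coefficients of the exponential function. *)
Let e (n : nat) : R[i] := (n`!%:R)^-1.

Lemma fact_inv_exp_type : exp_type e.
Proof.
exists 1, 1; split=> // n.
by rewrite /e mul1r /exp_coeff /= expr1n mul1r normfV normr_nat fmorphV rmorph_nat.
Qed.

Lemma psum_expR (s : R) : psum e s%:C = (expR s)%:C.
Proof.
apply: cvg_lim; first exact: norm_hausdorff.
have -> : series (fun n => e n * s%:C ^+ n) =
    fun n => (series (exp_coeff s) n)%:C.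
  apply/funext => n; rewrite /series /= rmorph_sum; apply: eq_bigr => i _.
  by rewrite /e /exp_coeff /= rmorphM rmorphXn fmorphV rmorph_nat mulrC.
exact: cvg_real_complex (is_cvg_series_exp_coeff s).
Qed.

Lemma cexp_real (s : R) : cexp s%:C = (expR s)%:C.
Proof. by rewrite /cexp /= cos0 sin0 -rmorphM mulr1. Qed.

Variable k : R[i].
Hypothesis hk : forall n : nat, k <> - 2^-1 - n%:R.

(** Stated in the variable t = x^2.  If w = 0, the coefficients of t show that
    m = m'.  Otherwise t = s / w with s real makes the exponential factor the real
    exponential, and the expansions up to order 3 are incompatible. *)
Lemma phi_gauss_inj m m' w :
  (forall t : R[i],
     psum (phi_coef k) (m * t) * cexp (w * t) = psum (phi_coef k) (m' * t)) ->
  w = 0 /\ m = m'.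
Proof.
move=> h; pose q : R[i] := k + 2^-1; have ephi := phi_coef_exp_type hk.
have q0 n : q + n%:R != 0 := shift_neq0 hk n.
have b0 : phi_coef k 0 = 1 := phi_coef0 k.
have b1 : phi_coef k 1 = q^-1.
  by rewrite phi_coefS b0 mul1r mul1r addr0.
have := q0 0%N; rewrite addr0 => qn0.
have [w0|w0] := eqVneq w 0.
  split=> //.
  have jm c := jet_psum 2 (exp_type_scale c ephi).
  have E : (fun s : R => psum (fun n => phi_coef k n * m ^+ n) s%:C) =
           (fun s : R => psum (fun n => phi_coef k n * m' ^+ n) s%:C).
    by apply/funext => s; rewrite !psum_scale -h w0 mul0r cexp0 mulr1.
  have := jm m; rewrite E => jE.
  have := jet_unique jE (jm m') (isT : (1 < 2)%N).
  rewrite !coef_poly /= !expr1 b1 => /mulfI; apply; exact: invr_neq0.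
exfalso; pose al := m / w; pose be := m' / w.
have j1 := jet_mul (jet_psum 4 (exp_type_scale al ephi))
  (jet_psum 4 fact_inv_exp_type).
have j2 := jet_psum 4 (exp_type_scale be ephi).
have E : (fun s : R => psum (fun n => phi_coef k n * al ^+ n) s%:C * psum e s%:C)
       = (fun s : R => psum (fun n => phi_coef k n * be ^+ n) s%:C).
  apply/funext => s; rewrite !psum_scale psum_expR -cexp_real /al /be.
  rewrite (mulrAC m) (mulrAC m') -!mulrA -h.
  by rewrite (mulrCA w) divff // mulr1.
rewrite E in j1.
have b2 : phi_coef k 2 = q^-1 / (2 * (q + 1)) by rewrite phi_coefS b1.
have b3 : phi_coef k 3 = q^-1 / (2 * (q + 1)) / (3 * (q + 2)).
  by rewrite phi_coefS b2.
have q1 : q + 1 != 0 := q0 1%N.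
have q2 : q + 2 != 0 := q0 2%N.
have E1 := jet_unique j1 j2 (isT : (1 < 4)%N).
have E2 := jet_unique j1 j2 (isT : (2 < 4)%N).
have E3 := jet_unique j1 j2 (isT : (3 < 4)%N).
rewrite !(coefM, coef_poly, big_ord_recl, big_ord0) /= in E1 E2 E3.
have e0 : e 0 = 1 by rewrite /e invr1.
have e1 : e 1 = 1 by rewrite /e invr1.
have e2 : e 2 = 2^-1 by [].
have e3 : e 3 = 6^-1 by [].
rewrite /bump /= !(subn0, subnn, subSS) b0 ?b1 ?b2 ?b3 e0 e1 ?e2 ?e3 in E1 E2 E3.
rewrite !(expr0, expr1, mulr1, mul1r, addr0) in E1 E2 E3.
exact: bessel_gauss_absurd qn0 q1 q2 E1 E2 E3.
Qed.

End Uniqueness.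

(** * The action of words *)

Section Words.
Context {R : realType}.
Implicit Types (A mu z lambda : R[i]) (t : R[i] * R[i] * R[i]).

Lemma cexpNK (u : R[i]) : cexp u * cexp (- u) = 1.
Proof. by rewrite -cexpD subrr cexp0. Qed.

Variables (k : R[i]) (hk : forall n : nat, k <> - 2^-1 - n%:R).

(** The sign of mu is not determined, and nothing is when A = 0; in both cases the
    two presentations still have the same image under a matrix. *)
Lemma gbfun_inj A mu z A' mu' z' :
  gbfun k (A, mu, z) = gbfun k (A', mu', z') ->
  A = A' /\ (A = 0 \/ mu ^+ 2 = mu' ^+ 2 /\ z = z').
Proof.
move=> E; have Ex x := congr1 (fun f : R[i] -> R[i] => f x) E.
have AA : A = A'.
  by have := Ex 0; rewrite /gbfun !mulr0 expr0n !mulr0 cexp0 phi0 // !mulr1.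
split=> //; have [A0|A0] := eqVneq A 0; [by left | right].
have [] := @phi_gauss_inj _ _ hk (mu ^+ 2) (mu' ^+ 2) (z - z').
  move=> t; have phit m : psum (phi_coef k) (m ^+ 2 * t) = phi k (m * sqrtc t).
    by rewrite phiE exprMn sqr_sqrtc.
  have /= := Ex (sqrtc t); rewrite sqr_sqrtc -AA !phit mulrBl cexpD.
  move: (phi k _) (phi k _) => f f'; rewrite -!(mulrA A) => /(mulfI A0) ff'.
  by rewrite mulrA ff' -mulrA cexpNK mulr1.
by move=> /eqP; rewrite subr_eq0 => /eqP -> ->.
Qed.

Variables (p : R[i] -> R[i]) (hp : formal_power (k + 2^-1) p).

Lemma gbfun_gbmove (G : 'M[int]_2) A mu z A' mu' z' :
  gbfun k (A, mu, z) = gbfun k (A', mu', z') ->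
  gbfun k (gbmove p G (A, mu, z)) = gbfun k (gbmove p G (A', mu', z')).
Proof.
move=> /gbfun_inj[-> []].
  by move=> A0; apply/funext => x; rewrite /= A0 !mul0r.
move=> [mm ->]; apply/funext => x; rewrite /gbmove /gbfun mm.
by rewrite (@phi_sqr _ k _ (mu' / gbden G z' * x)) // !exprMn mm.
Qed.

Lemma gbact_gbfun (G : 'M[int]_2) A mu z : gbden G z != 0 ->
  gbact k p G (gbfun k (A, mu, z)) = gbfun k (gbmove p G (A, mu, z)).
Proof.
move=> Gz; apply: xget_unique; first by exists A, mu, z.
by move=> g [A' [mu' [z' [_ E ->]]]]; exact/esym/gbfun_gbmove.
Qed.

Lemma formal_power1 : p 1 = 1.
Proof.
have := hp.2 1 ltr01; rewrite ln1 mulr0 cexp0; exact.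
Qed.

Lemma formal_powerMV u : u != 0 -> p u * p u^-1 = 1.
Proof. by move=> u0; rewrite -hp.1 ?invr_eq0 // divff // formal_power1. Qed.

(** For these matrices c z + d = 1, so the formula is multiplication by
    e^(b x^2), as it should be for tau_+ and its inverse. *)
Lemma gbmove_translation (b : int) A mu z :
  gbmove p (mx2 1 b 0 1) (A, mu, z) = (A, mu, z + b%:~R).
Proof.
rewrite /gbmove /gbden !mxE /= mul0r add0r formal_power1 !divr1 !mul0r.
by rewrite oppr0 cexp0 !mulr1 mul1r.
Qed.

Lemma lact_gbfun l A mu z : gbden (lmx l) z != 0 ->
  lact k p l (gbfun k (A, mu, z)) = gbfun k (gbmove p (lmx l) (A, mu, z)).
Proof.
case: l => Gz; try exact: gbact_gbfun.
- rewrite gbmove_translation; apply/funext => x.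
  by rewrite /lact /gbfun mulrDl cexpD mul1r mulrC !mulrA.
- rewrite gbmove_translation; apply/funext => x.
  by rewrite /lact /gbfun mulrDl cexpD mulN1r mulrC !mulrA.
Qed.

Lemma phi_op_gbfun lambda A z :
  phi_op k lambda (gbfun k (A, 0, z)) = gbfun k (A, lambda, z).
Proof.
by apply/funext => x; rewrite /phi_op /= mul0r phi0 // mulr1; ring.
Qed.

(** Writing delta = r - s z: the inverse word maps z to z' with denominator delta
    and divides the amplitude by the power of delta, the word maps z' back to z
    with denominator 1 / delta, and the two powers cancel.  The starting parameter
    is mu = 0, for which phi_mu = 1, so phi_op merely sets mu to lambda.

    Induction on the word, with the matrix (a, b; c, d) of its first letter: the
    values of z to be avoided are the pole of the inverse letter and the images
    under the letter of those excluded for the rest of the word. *)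
Lemma wact_gbfun lambda (w : seq letter) : exists bad : seq R[i],
  forall A z, z \notin bad ->
  wact_op k p w (phi_op k lambda) (gbfun k (A, 0, z)) =
  let: (r, s) := ((wmx w 0 0)%:~R, (wmx w 1 0)%:~R) in
  gbfun k (A * cexp (- (lambda ^+ 2 * s * (r - s * z))), lambda * (r - s * z), z).
Proof.
elim: w => [|l w [bad IH]].
  exists [::] => A z _.
  have -> : (wmx [::] 0 0)%:~R = 1 :> R[i] by rewrite mxE.
  have -> : (wmx [::] 1 0)%:~R = 0 :> R[i] by rewrite mxE.
  rewrite mul0r subr0 !mulr1 mulr0 oppr0 cexp0 mulr1; exact: phi_op_gbfun.
pose a : R[i] := (lmx l 0 0)%:~R; pose b : R[i] := (lmx l 0 1)%:~R.
pose c : R[i] := (lmx l 1 0)%:~R; pose d : R[i] := (lmx l 1 1)%:~R.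
have det1 : a * d = b * c + 1.
  by rewrite /a /b /c /d; case: (l); rewrite /= !mxE /=; ring.
have linvE : [/\ (lmx (linv l) 0 0)%:~R = d, (lmx (linv l) 0 1)%:~R = - b,
    (lmx (linv l) 1 0)%:~R = - c & (lmx (linv l) 1 1)%:~R = a].
  rewrite /a /b /c /d; case: (l); split; rewrite /= !mxE //=; ring.
(* If c = 0 the inverse letter has no pole, and a / c is the default value 0. *)
exists (a / c :: [seq (a * y + b) / (c * y + d) | y <- bad]) => A z.
rewrite inE negb_or => /andP[zac zbad].
have [linv00 linv01 linv10 linv11] := linvE.
set r : R[i] := (wmx w 0 0)%:~R; set s : R[i] := (wmx w 1 0)%:~R.
pose de : R[i] := a - c * z.
have deE : gbden (lmx (linv l)) z = de.
  by rewrite /gbden linv10 linv11 /de mulNr addrC.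
have de0 : de != 0.
  rewrite /de subr_eq0; apply: contra zac => /eqP acz.
  (* If c = 0 then a d = 1, so a is nonzero. *)
  have [c0|c0] := eqVneq c 0; last by rewrite acz mulrC mulKf.
  move: det1; rewrite acz c0 mul0r mulr0 mul0r add0r => /eqP.
  by rewrite eq_sym oner_eq0.
pose z' : R[i] := (d * z - b) / de.
have den' : gbden (lmx l) z' = de^-1.
  rewrite /gbden -/c -/d /z'.
  have -> : c * ((d * z - b) / de) + d = (a * d - b * c) / de.
    by rewrite /de in de0 *; field.
  by rewrite det1 addrAC subrr add0r mul1r.
have zE : (a * z' + b) / de^-1 = z.
  rewrite invrK mulrDl /z' -mulrA divfK // /de.
  have -> : a * (d * z - b) + b * (a - c * z) = (a * d - b * c) * z by ring.
  by rewrite det1 addrAC subrr add0r mul1r.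
have z'bad : z' \notin bad.
  apply: contra zbad => z'b; apply/mapP; exists z' => //.
  by have -> : c * z' + d = de^-1 := den'.
have moved : gbmove p (lmx (linv l)) (A, 0, z) = (A / p de, 0, z').
  rewrite /gbmove deE linv00 linv01 linv10 expr0n mulr0 oppr0 cexp0 mulr1 mul0r.
  by [].
have mxS i : (wmx (l :: w) i 0)%:~R = (lmx l i 0)%:~R * r + (lmx l i 1)%:~R * s.
  rewrite [wmx _]/= mxE !big_ord_recl big_ord0 addr0 rmorphD !rmorphM.
  by have -> : lift ord0 ord0 = 1 :> 'I_2 by apply/val_inj.
have -> : wact_op k p (l :: w) (phi_op k lambda) (gbfun k (A, 0, z)) =
  lact k p l (wact_op k p w (phi_op k lambda)
    (lact k p (linv l) (gbfun k (A, 0, z)))) by [].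
rewrite lact_gbfun ?deE // moved IH //.
rewrite [LHS]lact_gbfun; last by rewrite den' invr_eq0.
rewrite /gbmove den' -/a -/b -/c -/r -/s zE !mxS -/a -/b -/c -/d.
set r' := a * r + b * s; set s' := c * r + d * s.
have rE : r - s * z' = (r' - s' * z) / de.
  have -> : r - s * z' = (r * de - s * (d * z - b)) / de.
    by rewrite mulrBl mulfK // mulrA.
  by congr (_ / _); rewrite /de /r' /s'; ring.
(* The sum of the two exponents is - lambda^2 (r - s z') times the left side. *)
have sE : s + c * (r' - s' * z) = s' * de.
  rewrite -[s]mul1r -[X in X * s + _](addKr (b * c)) -det1 /r' /s' /de; ring.
rewrite rE.
have -> : lambda * ((r' - s' * z) / de) / de^-1 = lambda * (r' - s' * z).
  by rewrite invrK -mulrA divfK.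
congr (gbfun k (_, lambda * (r' - s' * z), z)).
rewrite (mulrAC _ (cexp _)) -(mulrA A) -invfM formal_powerMV // invr1 mulr1.
rewrite -(mulrA A) -cexpD; congr (A * cexp _); rewrite invrK.
have -> : - (lambda ^+ 2 * s' * (r' - s' * z)) =
    - (lambda ^+ 2 * (s' * de) * ((r' - s' * z) / de)).
  by rewrite -!mulrA (mulrCA de) divff // mulr1.
rewrite -sE; move: (r' - s' * z) => X.
have [Y ->] : exists Y : R[i], X = Y * de by exists (X / de); rewrite divfK.
rewrite mulfK //; ring.
Qed.

End Words.

(** * The limit z -> 0 *)

Lemma near_notin {R : realType} (bad : seq R[i]) :
  \forall z \near (0 : R[i])^', z \notin bad.
Proof.
have F0 : Filter (0 : R[i])^' := dnbhs_filter (0 : R[i]).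
elim: bad => [|y bad IH]; first exact: nearW.
have yP : \forall z \near (0 : R[i])^', z != y.
  have [->|y0] := eqVneq y 0; first exact: (@nbhs_dnbhs_neq R[i] 0).
  have [T T0 yT] := normc_realP y.
  have T_gt0 : 0 < T / 2 by rewrite divr_gt0 // -ltcR -yT normr_gt0.
  apply: nbhs_dnbhs; have := near_dist (0 : R[i]) T_gt0.
  apply: filterS => z; rewrite sub0r normrN; apply: contraTneq => ->.
  by rewrite yT lecR -ltNge; lra.
by apply: filterS2 yP IH => z zy zbad; rewrite inE negb_or zy.
Qed.

Theorem proposition2p9 (R : realType) (k lambda : R[i])
    (hk : forall n : nat, k <> - 2^-1 - n%:R)
    (p : R[i] -> R[i]) (hp : formal_power (k + 2^-1) p)
    (w : seq letter) (r s : int) (hrs : coprimez r s)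
    (hr : wmx w 0 0 = r) (hs : wmx w 1 0 = s) :
  [/\ cvg_at1 (wact_op k p w (phi_op k lambda)),
      at1 (wact_op k p w (phi_op k lambda)) =
        (fun x => cexp (- (lambda ^+ 2 * r%:~R * s%:~R)) *
                  phi k (r%:~R * lambda * x))
    & Jrat k p w lambda = cexp (- (lambda ^+ 2 * r%:~R * s%:~R))].
Proof.
set B := wact_op k p w (phi_op k lambda).
pose target (x : R[i]) := cexp (- (lambda ^+ 2 * r%:~R * s%:~R)) *
  phi k (r%:~R * lambda * x).
have lim_target x : B (gaussian z) x @[z --> 0^'] --> target x.
  have [bad badP] := wact_gbfun hk hp lambda w.
  pose r' : R[i] := r%:~R; pose s' : R[i] := s%:~R.
  pose F z : R[i] := cexp (- (lambda ^+ 2 * s' * (r' - s' * z))) *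
     phi k (lambda * (r' - s' * z) * x) * cexp (z * x ^+ 2).
  have F0 : Filter (0 : R[i])^' := dnbhs_filter (0 : R[i]).
  have BF : \forall z \near (0 : R[i])^', F z = B (gaussian z) x.
    apply: filterS (near_notin bad) => z zbad.
    have -> : gaussian z = gbfun k (1, 0, z).
      by apply/funext => y; rewrite /gbfun mul1r mul0r phi0 // mul1r.
    by rewrite /B (badP 1 z zbad) hr hs (mul1r (cexp _)).
  have FE : F 0 = target x.
    rewrite /F /target mulr0 subr0 mul0r cexp0 mulr1; congr (cexp _ * phi k _).
      by rewrite mulrAC.
    by rewrite (mulrC lambda).
  apply: cvg_trans (near_eq_cvg BF) _; rewrite -FE.
  have id0 : z @[z --> (0 : R[i])^'] --> (0 : R[i]) by exact: nbhs_dnbhs.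
  have lin : r' - s' * z @[z --> (0 : R[i])^'] --> r' - s' * 0.
    by apply: cvgB; [exact: cvg_cst | apply: cvgM id0; exact: cvg_cst].
  have comp (f g : R[i] -> R[i]) (l : R[i]) : continuous f ->
      g @ (0 : R[i])^' --> l -> f (g z) @[z --> (0 : R[i])^'] --> f l.
    by move=> cf gl; exact: (cvg_comp _ _ gl (cf l)).
  have cst (c : R[i]) : c @[_ --> (0 : R[i])^'] --> c by exact: cvg_cst.
  apply: cvgM; last by apply: comp (@cexp_continuous R) _; exact: cvgM id0 (cst _).
  apply: cvgM.
    by apply: comp (@cexp_continuous R) _; apply: cvgN; exact: cvgM (cst _) lin.
  apply: comp (phi_continuous hk) _; apply: cvgM (cst x).
  exact: cvgM (cst _) lin.
have cvgB : cvg_at1 B.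
  by move=> x; apply/cvg_ex; exists (target x); exact: lim_target.
have at1B : at1 B = target.
  apply/funext => x; apply: cvg_lim; last exact: lim_target.
  exact: norm_hausdorff.
split => //.
by rewrite /Jrat -/B at1B /target mulr0 phi0 // mulr1.
Qed.
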